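(* For every real $\beta>0$, $$\lim_{N\to\infty}\frac1N\sum_{m=0}^{N-1}|\eta(m)|^{\beta}=0.$$
   Context: The Thue--Morse sequence $(t_k)_{k\geqslant 0}$ with values $\pm1$ is defined by $t_0=1$, $t_{2k}=t_k$, $t_{2k+1}=-t_k$ for $k\geqslant 0$. Its balanced two-point correlation (autocorrelation) coefficients are $\eta(m)=\lim_{N\to\infty}\frac1N\sum_{k=0}^{N-1}t_kt_{k+m}$ for $m\in\mathbb{N}_0$ (the limit is known to exist). It is well known that $\eta(0)=1$, $\eta(2m)=\eta(m)$ and $\eta(2m+1)=-\frac12\bigl(\eta(m)+\eta(m+1)\bigr)$ for $m\geqslant 0$, which determines $\eta$ on $\mathbb{N}_0$. *)

(* Defs.v *)
From mathcomp Require Import all_boot all_order all_algebra.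
From mathcomp Require Import all_classical all_reals all_analysis.
From Stdlib Require BinNums BinNat Nnat.
Set Implicit Arguments.
Unset Strict Implicit.
Unset Printing Implicit Defensive.
Import Order.TTheory GRing.Theory Num.Theory.
Import numFieldNormedType.Exports.
Local Open Scope classical_set_scope.
Local Open Scope ring_scope.

(* The recursion [t_{2k} = t_k], [t_{2k+1} = - t_k] is run on the binary
   representation of the index; [xH] is the case [t_1 = - t_0]. The defining
   equations on [nat] are [thue_morse0], [thue_morse_even], [thue_morse_odd]. *)
Fixpoint thue_morse_pos (R : pzRingType) (p : BinNums.positive) : R :=
  match p with
  | BinNums.xH => - 1
  | BinNums.xO q => thue_morse_pos R q
  | BinNums.xI q => - thue_morse_pos R q
  end.

Definition thue_morse (R : pzRingType) (k : nat) : R :=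
  match BinNat.N.of_nat k with
  | BinNums.N0 => 1
  | BinNums.Npos p => thue_morse_pos R p
  end.

Lemma thue_morse0 (R : pzRingType) : thue_morse R 0 = 1.
Proof. by []. Qed.

Lemma thue_morse_even (R : pzRingType) (k : nat) :
  thue_morse R (2 * k) = thue_morse R k.
Proof.
rewrite /thue_morse -[(2 * k)%N]/(Nat.mul 2 k).
by rewrite Nnat.Nat2N.inj_double; case: (BinNat.N.of_nat k).
Qed.

Lemma thue_morse_odd (R : pzRingType) (k : nat) :
  thue_morse R (2 * k + 1) = - thue_morse R k.
Proof.
rewrite /thue_morse addn1 -[(2 * k).+1]/(S (Nat.mul 2 k)).
by rewrite Nnat.Nat2N.inj_succ_double; case: (BinNat.N.of_nat k).
Qed.

Definition eta (R : realType) (m : nat) : R :=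
  limn (fun N : nat =>
    N%:R^-1 * \sum_(0 <= k < N) thue_morse R k * thue_morse R (k + m)).

(* Main.v *)
(** Splitting the correlation sums by parity shows that the averages converge
    and yields the recursion for [eta].  Two steps of the recursion give
    [sum_(m < 4N) |eta m| <= 3 * sum_(m < N) |eta m| + 1]: from
    [a = eta m], [b = eta m.+1] the block of length 4 contributes
    [|a| + |a + b| / 2 + |a - b| / 2 <= 2|a| + |b|].
    As 3 < 4, the sum is [o(N)], and on [[0, 1]] one has
    [x `^ beta <= e + C_e * x] for every [e > 0]. *)
Require Import Defs.
From mathcomp Require Import all_boot all_order all_algebra.
From mathcomp Require Import all_classical all_reals all_analysis.
From mathcomp Require Import ring lra.
Import Order.TTheory GRing.Theory Num.Theory.
Import numFieldNormedType.Exports.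
Local Open Scope classical_set_scope.
Local Open Scope ring_scope.

(** * Sequences of growth o(N) and rescaling of the index *)

Definition linearly_bounded (R : realType) (e : R) (f : nat -> R) :=
  exists C : R, forall N, `|f N| <= e * N%:R + C.

(** This is o(N), phrased by affine bounds valid at every index: the additive constant replaces
    [eventually], so the bounds survive division of the index by [d]. *)
Definition sublinear (R : realType) (f : nat -> R) :=
  forall e : R, 0 < e -> linearly_bounded R e f.

(** Each index is [d * q + b] with [b < d] and [q <= N / d], so passing from [f] to [g] multiplies
    the slope by [r / d]. *)
Lemma linearly_bounded_dilate (R : realType) (f g : nat -> R) (d : nat)
    (r c e : R) :
  (0 < d)%N -> 0 <= r -> 0 <= e ->
  (forall N b, (b < d)%N -> `|g (d * N + b)%N| <= r * `|f N| + c) ->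
  linearly_bounded R e f -> linearly_bounded R (r / d%:R * e) g.
Proof.
move=> d0 r0 e0 fg [C fC]; exists (r * C + c) => N.
rewrite {1}(divn_eq N d) mulnC.
apply: (le_trans (fg _ _ (ltn_pmod N d0))).
have -> : r / d%:R * e * N%:R + (r * C + c) = r * (e * (N%:R / d%:R) + C) + c.
  by field; rewrite pnatr_eq0 -lt0n.
rewrite lerD2r ler_wpM2l// (le_trans (fC _))// lerD2r ler_wpM2l//.
by rewrite ler_pdivlMr ?ltr0n// -natrM ler_nat leq_divM.
Qed.

Lemma sublinear_dilate (R : realType) (f g : nat -> R) (d : nat) (r c : R) :
  (0 < d)%N -> 0 < r ->
  (forall N b, (b < d)%N -> `|g (d * N + b)%N| <= r * `|f N| + c) ->
  sublinear R f -> sublinear R g.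
Proof.
move=> d0 r0 fg fsub e e0.
have d0' : 0 < d%:R :> R by rewrite ltr0n.
have -> : e = r / d%:R * (e * d%:R / r).
  by field; rewrite !gt_eqF.
have e'0 : 0 < e * d%:R / r by rewrite divr_gt0// mulr_gt0.
apply: linearly_bounded_dilate fg (fsub _ e'0) => //; exact: ltW.
Qed.

(** The dilation bound is fed back into itself: from slope [K], after [k] rounds the slope is
    [(r / d) ^+ k * K], which tends to 0. The additive constant may grow with [k], but [k] is fixed
    once [e] is given. *)
Lemma sublinear_contraction (R : realType) (f : nat -> R) (d : nat)
    (r c K : R) :
  0 <= r -> r < d%:R -> 0 <= K ->
  (forall N, `|f N| <= K * N%:R) ->
  (forall N b, (b < d)%N -> `|f (d * N + b)%N| <= r * `|f N| + c) ->
  sublinear R f.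
Proof.
move=> r0 rd K0 fK ff e e0.
have d0 : 0 < d%:R :> R by exact: le_lt_trans rd.
have q0 : 0 <= r / d%:R by rewrite divr_ge0// ltW.
have iterates k : linearly_bounded R ((r / d%:R) ^+ k * K) f.
  elim: k => [|k IH]; first by exists 0 => N; rewrite mul1r addr0.
  rewrite exprS -mulrA; apply: linearly_bounded_dilate ff IH => //.
    by rewrite -(ltr0n R).
  by rewrite mulr_ge0// exprn_ge0.
have q1 : `|r / d%:R| < 1 by rewrite ger0_norm// ltr_pdivrMr// mul1r.
have : (fun k => (r / d%:R) ^+ k * K) @ \oo --> 0 * K.
  by apply: cvgMr_tmp; exact: cvg_expr.
rewrite mul0r => /cvgrPdist_lt /(_ _ e0)[k _ /(_ k (leqnn k))].
rewrite sub0r normrN => /(le_lt_trans (ler_norm _)) /ltW ke.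
have [C fC] := iterates k; exists C => N.
by rewrite (le_trans (fC N))// lerD2r ler_wpM2r.
Qed.

Lemma sublinearD (R : realType) (f g : nat -> R) :
  sublinear R f -> sublinear R g -> sublinear R (fun N => `|f N| + `|g N|).
Proof.
move=> fs gs e e0; have e20 : 0 < e / 2 by rewrite divr_gt0.
have [C fC] := fs _ e20; have [D gD] := gs _ e20.
exists (C + D) => N; move: (fC N) (gD N).
rewrite [`|_ + _|]ger0_norm ?addr_ge0// => /lerD h /h /le_trans; apply.
by rewrite addrACA -mulrDl -splitr.
Qed.

Lemma sublinear_cvg (R : realType) (f : nat -> R) :
  sublinear R f -> (fun N => N%:R^-1 * f N) @ \oo --> (0 : R).
Proof.
move=> fs; apply/cvgrPdist_le => e e0.
have [C fC] := fs _ (divr_gt0 e0 (ltr0Sn R 1)).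
near=> N; rewrite sub0r normrN normrM ger0_norm ?invr_ge0// mulrC.
have N0 : 0 < N%:R :> R by rewrite ltr0n; near: N; exact: nbhs_infty_gt.
rewrite ler_pdivrMr// (le_trans (fC N))// [e in leRHS]splitr mulrDl lerD2l.
rewrite -ler_pdivrMl ?divr_gt0//; near: N; exact: nbhs_infty_ger.
Unshelve. all: by end_near. Qed.

(** * Correlation sums of the Thue-Morse sequence and the recursion for [eta] *)

Lemma big_nat_double (V : zmodType) (F : nat -> V) N :
  \sum_(0 <= k < 2 * N) F k =
  \sum_(0 <= k < N) (F (2 * k)%N + F (2 * k + 1)%N).
Proof.
elim: N => [|N IH]; first by rewrite muln0 !big_geq.
by rewrite mulnS add2n !big_nat_recr//= IH addn1 addrA.
Qed.

Section correlation.
Variable R : realType.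
Local Notation t := (thue_morse R).

Definition correlation_sum (m N : nat) : R :=
  \sum_(0 <= k < N) t k * t (k + m)%N.
Local Notation S := correlation_sum.

Lemma norm_thue_morse k : `|t k| = 1.
Proof.
rewrite /thue_morse; case: BinNat.N.of_nat => [|p]; first by rewrite normr1.
by elim: p => [p IH|p IH|] //=; rewrite normrN ?normr1.
Qed.

Lemma correlation_sumS m N :
  exists2 x, `|x| <= 1 & S m (2 * N + 1) = S m (2 * N) + x.
Proof.
exists (t (2 * N)%N * t (2 * N + m)%N).
  by rewrite normrM !norm_thue_morse mulr1.
by rewrite addn1 /S big_nat_recr.
Qed.

Lemma norm_correlation_sum_le m N : `|S m N| <= N%:R.
Proof.
apply: (le_trans (ler_norm_sum _ _ _)).
rewrite (eq_bigr (fun=> 1)) ?sumr_const_nat ?subn0// => k _.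
by rewrite normrM !norm_thue_morse mulr1.
Qed.

Lemma correlation_sum_even m N : S (2 * m) (2 * N) = 2 * S m N.
Proof.
rewrite /S big_nat_double mulr_sumr; apply: eq_bigr => k _.
rewrite addnAC -mulnDr !thue_morse_even !thue_morse_odd mulrNN.
by rewrite mulr_natl mulr2n.
Qed.

Lemma correlation_sum_odd m N :
  S (2 * m + 1) (2 * N) = - (S m N + S m.+1 N).
Proof.
rewrite /S big_nat_double -big_split -sumrN; apply: eq_bigr => k _ /=.
rewrite addnA -mulnDr thue_morse_even !thue_morse_odd.
have -> : (2 * k + 1 + (2 * m + 1) = 2 * (k + m.+1))%N.
  by rewrite addnACA -mulnDr -mulnSr -addnS.
by rewrite thue_morse_even mulrN mulNr opprD.
Qed.

Lemma correlation_sum0 N : S 0 N = N%:R.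
Proof.
rewrite /S (eq_bigr (fun=> 1)) ?sumr_const_nat ?subn0// => k _.
rewrite addn0 -expr2 -[_ ^+ 2]ger0_norm ?sqr_ge0//.
by rewrite normrX norm_thue_morse expr1n.
Qed.

(** Equivalent to convergence of the averages to [a], but in the form to which the dilation and
    contraction lemmas apply. *)
Definition has_correlation m (a : R) := sublinear R (fun N => S m N - a * N%:R).

Lemma has_correlation_eta m a : has_correlation m a -> eta R m = a.
Proof.
move=> /sublinear_cvg ha; apply/cvg_lim => //.
have -> : a = 0 + a by rewrite add0r.
apply: cvg_trans (cvgD ha (cvg_cst a)); apply: near_eq_cvg.
(* At [N = 0] the inverse is 0 and the left side loses its summand [a], so the identity is claimed
   only for positive [N]. *)
near=> N; have N0 : (0 < N)%N by near: N; exact: nbhs_infty_gt.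
rewrite -/(S m N) -[LHS]/(N%:R^-1 * (S m N - a * N%:R) + a).
by field; rewrite pnatr_eq0 -lt0n.
Unshelve. all: by end_near. Qed.

(** An odd length adds one product of modulus 1 to the sum and one [a] to the linear term; it thus
    suffices to estimate even lengths. *)
Lemma correlation_residual_double m (a : R) N b : (b < 2)%N ->
  `|S m (2 * N + b) - a * (2 * N + b)%:R|
  <= `|S m (2 * N) - a * (2 * N)%:R| + (1 + `|a|).
Proof.
case: b => [|[|//]] _; first by rewrite addn0 lerDl addr_ge0.
have [y y1 ->] := correlation_sumS m N.
rewrite natrD mulrDr mulr1 opprD addrACA (le_trans (ler_normD _ _))//.
by rewrite lerD2l (le_trans (ler_normB _ _))// lerD2r.
Qed.

Lemma has_correlation0 : has_correlation 0 1.
Proof.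
move=> e e0; exists 0 => N.
by rewrite correlation_sum0 mul1r subrr normr0 addr0 mulr_ge0// ltW.
Qed.

(** The odd rule at [m = 0] refers back to [S 1] itself. The value solves [a = - (1 + a) / 2]; with
    it the residual at [2 * N] is minus the residual at [N], a contraction since 1 < 2. *)
Lemma has_correlation1 : has_correlation 1 (- 3^-1).
Proof.
apply: (@sublinear_contraction _ _ 2 1 (1 + `|- 3^-1|) 2) => //.
- by rewrite ltr1n.
- move=> N; rewrite (le_trans (ler_normB _ _))// mulr_natl mulr2n lerD//.
    exact: norm_correlation_sum_le.
  rewrite normrM normrN normr_nat ler_piMl// ger0_norm; lra.
move=> N b b2; apply: le_trans (correlation_residual_double _ _ _ _ b2) _.
rewrite lerD2r mul1r -[leRHS]normrN (correlation_sum_odd 0 N) correlation_sum0.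
by rewrite natrM le_eqVlt; apply/predU1l; congr (`|_|); field.
Qed.

Lemma has_correlation_even m a :
  has_correlation m a -> has_correlation (2 * m) a.
Proof.
apply: (@sublinear_dilate _ _ _ 2 2 (1 + `|a|)) => // N b b2.
apply: le_trans (correlation_residual_double _ _ _ _ b2) _.
by rewrite correlation_sum_even natrM mulrCA -mulrBr normrM normr_nat.
Qed.

(** At length [2 * N] the residual is minus the sum of the residuals for [m] and [m.+1] at length
    [N]. *)
Lemma has_correlation_odd m a b : has_correlation m a ->
  has_correlation m.+1 b -> has_correlation (2 * m + 1) (- ((a + b) / 2)).
Proof.
move=> ha hb.
have := sublinearD _ _ _ ha hb.
apply: (@sublinear_dilate _ _ _ 2 1 (1 + `|- ((a + b) / 2)|)) => //.
move=> N i i2; apply: le_trans (correlation_residual_double _ _ _ _ i2) _.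
rewrite lerD2r mul1r [leRHS]ger0_norm ?addr_ge0//.
apply: le_trans (ler_normD _ _); rewrite -[leRHS]normrN correlation_sum_odd.
by rewrite natrM le_eqVlt; apply/predU1l; congr (`|_|); field.
Qed.

Lemma eta_has_correlation m : has_correlation m (eta R m).
Proof.
suff [a ha] : exists a, has_correlation m a.
  by rewrite (has_correlation_eta _ _ ha).
elim/ltn_ind: m => -[_|[_|m IH]].
- by exists 1; exact: has_correlation0.
- by exists (- 3^-1); exact: has_correlation1.
have hlt : (m./2.+1 < m.+2)%N.
  by rewrite !ltnS leq_half_double -addnn -addSn leq_addl.
have [a ha] := IH _ hlt.
have -> : m.+2 = (2 * m./2.+1 + odd m)%N.
  by rewrite -{1}(odd_double_half m) addnC mul2n doubleS.
case: (boolP (odd m)) => om /=; last first.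
  by rewrite addn0; exists a; exact: has_correlation_even.
(* Oddness of [m] excludes [m = 0], where this inequality fails; that case is index 2, which is
   even. *)
have hlt2 : (m./2.+2 < m.+2)%N.
  by rewrite !ltnS -{2}(odd_double_half m) om -addnn add1n ltnS leq_addl.
have [b hb] := IH _ hlt2.
by exists (- ((a + b) / 2)); exact: has_correlation_odd.
Qed.

Lemma eta0 : eta R 0 = 1.
Proof. exact/has_correlation_eta/has_correlation0. Qed.

Lemma eta_even m : eta R (2 * m) = eta R m.
Proof. exact/has_correlation_eta/has_correlation_even/eta_has_correlation. Qed.

Lemma eta_odd m : eta R (2 * m + 1) = - ((eta R m + eta R m.+1) / 2).
Proof.
by apply/has_correlation_eta/has_correlation_odd; exact: eta_has_correlation.
Qed.

(** The averages have modulus at most 1, and one of them lies within [e] of [eta R m]. *)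
Lemma norm_eta_le1 m : `|eta R m| <= 1.
Proof.
apply/ler_addgt0Pr => e e0.
have /sublinear_cvg /cvgrPdist_lt /(_ _ e0) [N _] := eta_has_correlation m.
move=> /(_ N.+1 (leqnSn N)).
rewrite sub0r normrN mulrBr mulrCA mulVf ?pnatr_eq0// mulr1 => h.
have -> : eta R m = N.+1%:R^-1 * S m N.+1 - (N.+1%:R^-1 * S m N.+1 - eta R m).
  by rewrite subKr.
rewrite (le_trans (ler_normB _ _))// lerD// ?(ltW h)// normrM.
rewrite ger0_norm ?invr_ge0// ler_pdivrMl ?ltr0n// mulr1.
exact: norm_correlation_sum_le.
Qed.

(** * Growth of the sums of [|eta m|] *)

Definition norm_eta_sum N := \sum_(0 <= m < N) `|eta R m|.
Local Notation A := norm_eta_sum.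

Lemma norm_eta_sum_le N : `|A N| <= N%:R.
Proof.
rewrite ger0_norm ?sumr_ge0// -[leRHS]mulr1.
have -> : N%:R * 1 = \sum_(0 <= m < N) (1 : R).
  by rewrite sumr_const_nat subn0 mulr1.
by apply: ler_sum => m _; exact: norm_eta_le1.
Qed.

(* With [a = eta m] and [b = eta m.+1], the four values of [eta] from index
   [4 * m] on are [a, (b - a) / 4, - (a + b) / 2, (a - b) / 4]. *)
Lemma norm_eta_block m :
  `|eta R (2 * (2 * m))| + `|eta R (2 * (2 * m) + 1)| +
  (`|eta R (2 * (2 * m + 1))| + `|eta R (2 * (2 * m + 1) + 1)|)
  <= 2 * `|eta R m| + `|eta R m.+1|.
Proof.
have -> : eta R (2 * (2 * m + 1) + 1) =
    - ((eta R (2 * m + 1) + eta R (2 * m.+1)) / 2).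
  by rewrite eta_odd mulnS addn1 add2n.
rewrite eta_odd -(addn1 (2 * m)) !eta_even eta_odd.
move: (eta R m) (eta R m.+1) => a b.
have -> : - ((a - (a + b) / 2) / 2) = - (4^-1 * (a - b)) by field.
have -> : - ((a + b) / 2) = - (2^-1 * (a + b)) by field.
have -> : (- (2^-1 * (a + b)) + b) / 2 = - (4^-1 * (a - b)) by field.
rewrite !normrN !normrM [`|4^-1|]ger0_norm ?[`|2^-1|]ger0_norm ?invr_ge0//.
have := ler_normD a b; have := ler_normB a b; lra.
Qed.

Lemma norm_eta_sum_quadruple N : A (4 * N) <= 3 * A N + 1.
Proof.
rewrite -[4%N]/(2 * 2)%N -mulnA /A !big_nat_double.
apply: (@le_trans _ _ (\sum_(0 <= m < N) (2 * `|eta R m| + `|eta R m.+1|))).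
  by apply: ler_sum => m _; exact: norm_eta_block.
rewrite big_split/= -mulr_sumr.
(* The shifted sum differs from [A N] only by boundary terms, so the block bound [2|a| + |b|] sums
   to the factor 3. *)
have : \sum_(0 <= m < N) `|eta R m.+1| + `|eta R 0| = A N + `|eta R N|.
  by rewrite /A -big_nat_recr//= big_nat_recl//= addrC.
have := norm_eta_le1 N; rewrite eta0 normr1 /A; lra.
Qed.

Lemma norm_eta_sum_sublinear : sublinear R A.
Proof.
apply: (@sublinear_contraction _ _ 4 3 4 1) => //.
- by rewrite ltr_nat.
- by move=> N; rewrite mul1r norm_eta_sum_le.
move=> N b b4; rewrite !ger0_norm ?sumr_ge0//.
have -> : A (4 * N + b) = A (4 * N) + \sum_(4 * N <= m < 4 * N + b) `|eta R m|.
  by rewrite /A -big_cat_nat// leq_addr.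
(* The 1 comes from the quadrupling bound, the 3 from at most three further terms, each at most
   1. *)
have -> : 4 = 1 + 3 :> R by lra.
rewrite addrA lerD ?norm_eta_sum_quadruple//.
have h : \sum_(4 * N <= m < 4 * N + b) `|eta R m| <= b%:R.
  apply: (@le_trans _ _ (\sum_(4 * N <= m < 4 * N + b) 1)).
    by apply: ler_sum => m _; exact: norm_eta_le1.
  by rewrite sumr_const_nat addKn.
by rewrite (le_trans h)// ler_nat -ltnS.
Qed.

End correlation.

(** * From exponent 1 to exponent [beta] *)

Lemma powR_le_affine (R : realType) (beta e t : R) : 0 < beta -> 0 < e ->
  0 <= t <= 1 -> t `^ beta <= e + t / (e `^ beta^-1).
Proof.
move=> b0 e0 /andP[t0 t1]; set d := e `^ _.
have d0 : 0 < d by exact: powR_gt0.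
(* Up to the cut-off [d], whose power with exponent [beta] is [e], monotonicity suffices; beyond it,
   [t / d] exceeds 1 while the power of [t] is at most 1. *)
have [td|dt] := leP t d.
  apply: (@le_trans _ _ e); last by rewrite lerDl divr_ge0// ltW.
  apply: (@le_trans _ _ (d `^ beta)).
    by rewrite ge0_ler_powR ?nnegrE ?(ltW b0) ?(ltW d0).
  by rewrite /d -powRrM mulVf ?gt_eqF// powRr1// ltW.
apply: (@le_trans _ _ 1).
  have : t `^ beta <= 1 `^ beta by rewrite ge0_ler_powR ?nnegrE ?(ltW b0).
  by rewrite powR1.
by rewrite ler_wpDl ?(ltW e0)// ler_pdivlMr// mul1r ltW.
Qed.

Theorem theorem3p7 (R : realType) (beta : R) (hbeta : 0 < beta) :
  (fun N : nat => N%:R^-1 * \sum_(0 <= m < N) (`|eta R m| `^ beta))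
    @ \oo --> (0 : R).
Proof.
apply: sublinear_cvg => e e0.
have e20 : 0 < e / 2 by rewrite divr_gt0.
set d := (e / 2) `^ beta^-1.
have d0 : 0 < d by exact: powR_gt0.
(* The slope [e / 2 * d] becomes [e / 2] after division by [d]; the constant term of the affine
   bound supplies the other half. *)
have [C AC] := norm_eta_sum_sublinear R _ (mulr_gt0 e20 d0).
exists (C / d) => N.
rewrite ger0_norm; last by apply: sumr_ge0 => m _; exact: powR_ge0.
have bound m : `|eta R m| `^ beta <= e / 2 + `|eta R m| / d.
  by apply: powR_le_affine => //; rewrite normr_ge0 norm_eta_le1.
apply: (@le_trans _ _ (\sum_(0 <= m < N) (e / 2 + `|eta R m| / d))).
  by apply: ler_sum.
rewrite big_split/= sumr_const_nat subn0 -mulr_suml -(mulr_natr (e / 2)).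
rewrite [e in leRHS]splitr mulrDl -addrA lerD2l.
have := le_trans (ler_norm _) (AC N).
rewrite -(ler_pM2r (x := d^-1)) ?invr_gt0// => /le_trans; apply.
by rewrite mulrDl lerD2r mulrAC -(mulrA (e / 2)) mulfV ?gt_eqF// mulr1.
Qed.
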